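(* Let $E: y^2=x^3+ax^2+bx+c$ ($a,b,c\in\mathbb{Z}$) be an elliptic curve, $P\in E(\mathbb{Q})$ a point of infinite order, and $k\ge1$. If $2^kP\not\equiv(0:1:0)\pmod 2$ (i.e. $e_k$ is odd), then $F_k(E,P)$ is odd and $\tau_k$ is even.
   Context: An elliptic curve is a non-singular cubic $y^2=x^3+ax^2+bx+c$ with $a,b,c\in\mathbb{Z}$. For $k\ge0$ write $2^kP=\left(\frac{m_k}{e_k^2},\frac{n_k}{e_k^3}\right)$ with $m_k,n_k,e_k\in\mathbb{Z}$, $e_k\ge1$, $\gcd(m_k,e_k)=\gcd(n_k,e_k)=1$; it reduces mod $2$ to $(m_ke_k:n_k:e_k^3)\bmod 2$, which is $(0:1:0)$ iff $2\mid e_k$. Define $F_0(E,P)=e_0$, $F_k(E,P)=e_k/e_{k-1}$ and $\tau_k=\frac{2n_{k-1}}{F_k(E,P)}\in\mathbb{Z}$ for $k\ge1$. *)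

(* Defs.v *)
From HB Require Import structures.
From mathcomp Require Import all_boot all_order all_algebra all_field.

Set Implicit Arguments.
Unset Strict Implicit.
Unset Printing Implicit Defensive.

Import Order.TTheory GRing.Theory Num.Theory.
Local Open Scope ring_scope.

(* No geometric point of the affine curve kills both partial derivatives of
   y^2 - (x^3 + a x^2 + b x + c); the point at infinity of such a curve is
   always smooth. *)
Definition nonsingular (a b c : int) : Prop :=
  forall x y : algC,
    y ^+ 2 = x ^+ 3 + a%:~R * x ^+ 2 + b%:~R * x + c%:~R ->
    ~ (2 * y = 0 /\ 3 * x ^+ 2 + 2 * a%:~R * x + b%:~R = 0).

Variant point : Type := Infinity | Affine of rat & rat.

Definition on_curve (a b c : int) (P : point) : Prop :=
  match P with
  | Infinity => True
  | Affine x y => y ^+ 2 = x ^+ 3 + a%:~R * x ^+ 2 + b%:~R * x + c%:~R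
  end.

(* Chord-and-tangent law; c does not occur in the formulas.  In the tangent
   branch, for points of the curve, y1 = y2 != 0. *)
Definition addp (a b : int) (P Q : point) : point :=
  match P, Q with
  | Infinity, _ => Q
  | _, Infinity => P
  | Affine x1 y1, Affine x2 y2 =>
    let chord l :=
      let x3 := l ^+ 2 - a%:~R - x1 - x2 in
      Affine x3 (l * (x1 - x3) - y1) in
    if x1 != x2 then chord ((y2 - y1) / (x2 - x1))
    else if y1 == - y2 then Infinity
    else chord ((3 * x1 ^+ 2 + 2 * a%:~R * x1 + b%:~R) / (2 * y1))
  end.

Definition mulp (a b : int) (n : nat) (P : point) : point :=
  iter n (addp a b P) Infinity.

Definition infinite_order (a b : int) (P : point) : Prop :=
  forall n : nat, (0 < n)%N -> mulp a b n P <> Infinity.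

(* 2^k P, as the k-fold iterate of Q |-> Q + Q at P. *)
Definition mul2exp (a b : int) (k : nat) (P : point) : point :=
  iter k (fun Q => addp a b Q Q) P.

Definition lowest_terms (Q : point) (m n e : int) : Prop :=
  [/\ Q = Affine (m%:~R / e%:~R ^+ 2) (n%:~R / e%:~R ^+ 3),
      1 <= e, coprimez m e & coprimez n e].

Definition proj_coords2 (m n e : int) : 'F_2 * 'F_2 * 'F_2 :=
  ((m * e)%:~R, n%:~R, (e ^+ 3)%:~R).

Definition proj_eq2 (u v : 'F_2 * 'F_2 * 'F_2) : Prop :=
  exists2 l : 'F_2, l != 0 &
    [/\ u.1.1 = l * v.1.1, u.1.2 = l * v.1.2 & u.2 = l * v.2].

Definition Fnum (e : nat -> int) (k : nat) : rat :=
  if k is j.+1 then (e k)%:~R / (e j)%:~R else (e 0%N)%:~R.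

Definition tau (n e : nat -> int) (k : nat) : rat :=
  2 * (n k.-1)%:~R / Fnum e k.

(* Parity of a rational number; both predicates force it to be an integer. *)
Definition rat_odd (q : rat) : Prop := exists z : int, q = (2 * z + 1)%:~R.
Definition rat_even (q : rat) : Prop := exists z : int, q = (2 * z)%:~R.

(* Main.v *)
Require Import Defs.
From HB Require Import structures.
From mathcomp Require Import all_boot all_order all_algebra all_field.
From mathcomp Require Import ring.

Set Implicit Arguments.
Unset Strict Implicit.
Unset Printing Implicit Defensive.

Import Order.TTheory GRing.Theory Num.Theory.
Local Open Scope ring_scope.

(** Write [Q = (m / e^2, n / e^3)] and [2Q = (m' / e'^2, n' / e'^3)] in lowest
terms. The tangent formula gives [x(2Q) = A / (2 n e)^2] with
[A = D^2 - 4 n^2 (a e^2 + 2 m)] and [D = 3 m^2 + 2 a m e^2 + b e^4]. The curve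
equation gives [n^2 = m^3 (mod e)], hence [A = m^4 (mod e)] is prime to [e];
comparing denominators, [e] divides [e'] and [e'] divides [2 n e]. So
[F = e' / e] and [tau = 2 n e / e'] are integers with [F * tau = 2 n], and if
[e'] is odd then so is its divisor [F], which forces [tau] to be even. *)

(** In characteristic 0, [y = - y] only for [y = 0], so a finite double excludes a vertical tangent
    and the slope [l] has a nonzero denominator. *)
Lemma addp_self_neq_Infinity (a b : int) (x y : rat) :
  addp a b (Affine x y) (Affine x y) <> Infinity ->
  let l := (3 * x ^+ 2 + 2 * a%:~R * x + b%:~R) / (2 * y) in
  let x3 := l ^+ 2 - a%:~R - x - x in
  y != 0 /\
  addp a b (Affine x y) (Affine x y) = Affine x3 (l * (x - x3) - y).
Proof.
rewrite /addp eqxx /= -addr_eq0 -mulr2n mulrn_eq0 /=.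
by case: eqVneq.
Qed.

Lemma on_curve_addp_self (a b c : int) (Q : point) :
  on_curve a b c Q -> on_curve a b c (addp a b Q Q).
Proof.
case: Q => [|x y] // hQ.
case E: (addp a b _ _) => [|x' y'] //.
have [|y0 def2Q] := @addp_self_neq_Infinity a b x y; first by rewrite E.
move: E; rewrite {}def2Q.
set l := (_ / (2 * y)) => -[<- <-] /=.
(* Solving the slope formula for [b] and the curve equation for [c] reduces the goal to a polynomial
   identity in [a], [x], [y], [l]. *)
have hb : b%:~R = 2 * y * l - 3 * x ^+ 2 - 2 * a%:~R * x.
  by rewrite /l; field.
have hc : c%:~R = y ^+ 2 - (x ^+ 3 + a%:~R * x ^+ 2 + b%:~R * x).
  by move: hQ => /= ->; ring.
by rewrite hc hb; ring.
Qed.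

Lemma on_curve_mul2exp (a b c : int) (k : nat) (P : point) :
  on_curve a b c P -> on_curve a b c (mul2exp a b k P).
Proof. by move=> hP; elim: k => //= k; apply: on_curve_addp_self. Qed.

Lemma lowest_terms_curve_eq (a b c m n e : int) (Q : point) :
  lowest_terms Q m n e -> on_curve a b c Q ->
  n ^+ 2 = m ^+ 3 + a * m ^+ 2 * e ^+ 2 + b * m * e ^+ 4 + c * e ^+ 6.
Proof.
case=> -> e_ge1 _ _ /= hQ.
have e0 : e%:~R != 0 :> rat by rewrite intr_eq0 gt_eqF.
apply: (@intr_inj rat); rewrite !(rmorphXn, rmorphD, rmorphM) /=.
have -> : n%:~R ^+ 2 = (n%:~R / e%:~R ^+ 3) ^+ 2 * e%:~R ^+ 6 :> rat by field.
by rewrite hQ; field.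
Qed.

Lemma lowest_terms_double_x (a b m n e m' n' e' : int) (Q : point) :
  lowest_terms Q m n e -> lowest_terms (addp a b Q Q) m' n' e' ->
  ((3 * m ^+ 2 + 2 * a * m * e ^+ 2 + b * e ^+ 4) ^+ 2
     - 4 * n ^+ 2 * (a * e ^+ 2 + 2 * m)) * e' ^+ 2 = m' * (2 * n * e) ^+ 2.
Proof.
case=> -> e_ge1 _ _ [def2Q e'_ge1 _ _].
have e0 : e%:~R != 0 :> rat by rewrite intr_eq0 gt_eqF.
have e'0 : e'%:~R != 0 :> rat by rewrite intr_eq0 gt_eqF.
have [|y0] := @addp_self_neq_Infinity a b (m%:~R / e%:~R ^+ 2) (n%:~R / e%:~R ^+ 3).
  by rewrite def2Q.
have n0 : n%:~R != 0 :> rat.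
  by apply: contraNneq y0 => ->; rewrite mul0r.
rewrite def2Q => -[hx _].
apply: (@intr_inj rat).
rewrite !(rmorphXn, rmorphB, rmorphD, rmorphM) /=.
(* This exposes the abscissa of [2Q], which [hx] equates with the tangent formula. *)
have -> : m'%:~R = m'%:~R / e'%:~R ^+ 2 * e'%:~R ^+ 2 :> rat by field.
by rewrite hx; field; rewrite n0 e0.
Qed.

Lemma dvdz_sqr (d m : int) : (d ^+ 2 %| m ^+ 2)%Z = (d %| m)%Z.
Proof. by rewrite !dvdzE !abszX dvdn_pexp2r. Qed.

Lemma lowest_terms_double_dvd (a b c m n e m' n' e' : int) (Q : point) :
  on_curve a b c Q ->
  lowest_terms Q m n e -> lowest_terms (addp a b Q Q) m' n' e' ->
  (e %| e')%Z /\ (e' %| 2 * n * e)%Z.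
Proof.
move=> hQ hlt hlt'.
have hx := lowest_terms_double_x hlt hlt'.
have curve := lowest_terms_curve_eq hlt hQ.
case: hlt hlt' => [_ _ cop_me _] [_ _ cop_me' _].
move: hx; set A := (_ - _) => hx; split; rewrite -dvdz_sqr.
  (* Once [n ^+ 2] is replaced through the curve equation, the terms free of [e] are
     [9 * m ^+ 4 - 8 * m ^+ 4]; the witness is the rest divided by [e]. *)
  have [q defA] : exists q, A = m ^+ 4 + q * e.
    exists (8 * a * m ^+ 3 * e + (4 * a ^+ 2 * m ^+ 2 + 6 * b * m ^+ 2) * e ^+ 3
            + 4 * a * b * m * e ^+ 5 + b ^+ 2 * e ^+ 7
            - 4 * (a * m ^+ 2 * e + b * m * e ^+ 3 + c * e ^+ 5)
                * (a * e ^+ 2 + 2 * m)).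
    by rewrite /A curve; ring.
  have copA : coprimez (e ^+ 2) A.
    rewrite coprimezXl // /coprimez defA addrC gcdzMDl -/(coprimez _ _).
    by rewrite coprimezXr // coprimez_sym.
  by rewrite -(Gauss_dvdzr _ copA) hx exprMn mulrA dvdz_mull.
have cop_e'm' : coprimez (e' ^+ 2) m' by rewrite coprimezXl // coprimez_sym.
by rewrite -(Gauss_dvdzr _ cop_e'm') -hx dvdz_mull.
Qed.

(** Used contrapositively, to turn the hypothesis on the reduction into a parity. An even [e] forces
    [n] to be odd, so the reduced triple is already [(0, 1, 0)], with scalar 1. *)
Lemma proj_eq2_infinity (m n e : int) :
  coprimez n e -> (2 %| e)%Z -> proj_eq2 (proj_coords2 m n e) (0, 1, 0).
Proof.
move=> cop_ne /dvdzP[z def_e].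
have z2 : 2%:~R = 0 :> 'F_2 by apply/val_inj.
have e0 : e%:~R = 0 :> 'F_2 by rewrite def_e rmorphM /= z2 mulr0.
have n1 : n%:~R = 1 :> 'F_2.
  have n_neq0 : n%:~R != 0 :> 'F_2.
    have /coprimezP[[u v] /= bezout] := cop_ne.
    (* If [n] were also even, the Bezout relation would read 0 = 1 modulo 2. *)
    apply/eqP => n0; have := congr1 (fun z : int => z%:~R : 'F_2) bezout.
    by rewrite rmorphD !rmorphM /= n0 e0 !mulr0.
  by case: (n%:~R) n_neq0 => [[|[|]]] // i _; apply/val_inj.
exists 1 => //; rewrite /proj_coords2 /=.
by rewrite rmorphM rmorphXn /= e0 n1 !(mulr0, mulr1) expr0n.
Qed.

Lemma not_dvd2z_odd (z : int) : ~~ (2 %| z)%Z -> exists w, z = 2 * w + 1.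
Proof.
move=> z_odd; exists (z %/ 2)%Z; rewrite {1}(divz_eq z 2) mulrC; congr (_ + _).
have := @ltz_pmod z 2 isT; have := @modz_ge0 z 2 isT.
by move: z_odd; rewrite (sameP dvdz_mod0P eqP); case: (z %% 2)%Z => [[|[|]]|].
Qed.

Theorem theorem5p7 (a b c : int) (P : point) (m n e : nat -> int) (k : nat)
    (hE : nonsingular a b c)
    (hP : on_curve a b c P)
    (hinf : infinite_order a b P)
    (hmne : forall j : nat,
       lowest_terms (mul2exp a b j P) (m j) (n j) (e j))
    (hk : (1 <= k)%N)
    (hred : ~ proj_eq2 (proj_coords2 (m k) (n k) (e k)) (0, 1, 0)) :
  rat_odd (Fnum e k) /\ rat_even (tau n e k).
Proof.
case: k hk hred => // j _ hred.
have [_ e_ge1 _ _] := hmne j; have [_ e'_ge1 _ cop'] := hmne j.+1.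
have [] := lowest_terms_double_dvd (on_curve_mul2exp j hP) (hmne j) (hmne j.+1).
case/dvdzP=> F def_e' /dvdzP[t def_2ne].
have F_odd : ~~ (2 %| F)%Z.
  apply/negP => F_even; apply: hred; apply: proj_eq2_infinity cop' _.
  by rewrite def_e' dvdz_mulr.
have e0 : e j != 0 by rewrite gt_eqF.
have def_2n : 2 * n j = t * F.
  by apply: (mulIf e0); rewrite def_2ne def_e' mulrA.
(* Zero is even, so an odd [F] is nonzero and the division in [tau] is a genuine one. *)
have F0 : F != 0 by apply: contraNneq F_odd => ->.
have FnumE : Fnum e j.+1 = F%:~R.
  by rewrite /= def_e' rmorphM /= mulfK // intr_eq0.
have tauE : tau n e j.+1 = t%:~R.
  rewrite /tau FnumE -[2]/(2%:~R) -rmorphM /= def_2n rmorphM /= mulfK //.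
  by rewrite intr_eq0.
rewrite FnumE tauE; split.
  by have [w ->] := not_dvd2z_odd F_odd; exists w.
have cop2F : coprimez 2 F by rewrite coprimezE prime_coprime.
have : (2 %| t)%Z by rewrite -(Gauss_dvdzl _ cop2F) -def_2n dvdz_mulr.
by case/dvdzP=> w ->; exists w; rewrite mulrC.
Qed.
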